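(* Let $Y$ be a real vector space and $F\subseteq Y$. Suppose $\succ$ is a (not necessarily strict) preference relation on $Y$ with domination structure $D_\succ$, and let $D\subseteq Y$. (a) If $D_\succ(y)=D$ for all $y\in F$, then $\operatorname{Min}(F,\succ)=\operatorname{Eff}(F,D\setminus(-D))$. If, in this situation, $\succ$ is asymmetric or antisymmetric, then $\operatorname{Min}(F,\succ)=\operatorname{Eff}(F,D)$. (b) If $D_\succ(y)\subseteq D$ for all $y\in F$, then $\operatorname{Eff}(F,D)\subseteq\operatorname{Min}(F,\succ)$. (c) If $\succ$ is asymmetric or antisymmetric and $D\subseteq D_\succ(y)$ for all $y\in F$, then $\operatorname{Min}(F,\succ)\subseteq\operatorname{Eff}(F,D)$.
   Context: A (not necessarily strict) preference relation on $Y$ is here just a binary relation $\succ$ on $Y$ (no further axioms are imposed). Its domination structure is the map $D_\succ:Y\to\mathcal{P}(Y)$, $D_\succ(y):=\{d\in Y\mid y\succ y+d\}$. For $F\subseteq Y$, $\operatorname{Min}(F,\succ):=\{y^0\in F\mid\forall y\in F:\ (y\succ y^0\Rightarrow y^0\succ y)\}$. For $F,D\subseteq Y$, $\operatorname{Eff}(F,D):=\{y^0\in F\mid F\cap(y^0-D)\subseteq\{y^0\}\}$. Asymmetric: $y^1\succ y^2$ implies not $y^2\succ y^1$. Antisymmetric: $y^1\succ y^2$ and $y^2\succ y^1$ imply $y^1=y^2$. *)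

(* Defs.v *)
From mathcomp Require Import all_boot all_algebra.
From mathcomp Require Import all_classical.

Set Implicit Arguments.
Unset Strict Implicit.
Unset Printing Implicit Defensive.

Import GRing.Theory.
Local Open Scope classical_set_scope.
Local Open Scope ring_scope.

(* Read [succ y1 y2] as "y1 is preferred to y2". *)
Definition domination (Y : zmodType) (succ : Y -> Y -> Prop) (y : Y) : set Y :=
  [set d | succ y (y + d)].

Definition Min (Y : Type) (F : set Y) (succ : Y -> Y -> Prop) : set Y :=
  [set y0 | F y0 /\ forall y, F y -> succ y y0 -> succ y0 y].

Definition Eff (Y : zmodType) (F D : set Y) : set Y :=
  [set y0 | F y0 /\ F `&` [set y0 - d | d in D] `<=` [set y0]].

(* Main.v *)
Require Import Defs.
From mathcomp Require Import all_boot all_order all_algebra.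
From mathcomp Require Import all_classical all_reals.
From Stdlib Require Import RelationClasses.

(** For points [y], [y0] of [F], [succ y y0] says that the difference [y0 - y]
    lies in the domination set of [y], and [y0] is efficient for [D] when
    [y0 - y \in D] forces [y = y0] for all [y] in [F] ([EffP]).  So both kinds of
    optimality are conditions on differences, and they can be compared pointwise.

    When every domination set is [D], minimality of [y0] means that
    [y0 - y \in D] implies [y - y0 \in D], that is, [y0 - y] is never in
    [D `\` - D].  Efficiency for [D `\` - D] would still permit this for
    [y = y0], but [0] is its own opposite and hence never lies in [D `\` - D]
    ([Min_const_domination]).

    Efficiency for a set containing the domination sets leaves [y0] itself as
    the only possible point preferred to [y0], which makes [y0] minimal
    ([Eff_sub_Min]).  Conversely, for a minimal [y0], if [y] in [F] has
    [y0 - y] in its domination set, then each of [y], [y0] is preferred to the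
    other: asymmetry excludes such a [y], and antisymmetry makes it equal to [y0]
    ([Min_sub_Eff]).  The two inclusions together give the equality of minimal
    and efficient points for constant domination sets. *)

Set Implicit Arguments.
Unset Strict Implicit.
Unset Printing Implicit Defensive.

Import GRing.Theory.
Local Open Scope classical_set_scope.
Local Open Scope ring_scope.

Lemma dominationB (Y : zmodType) (succ : Y -> Y -> Prop) (y y0 : Y) :
  domination succ y (y0 - y) = succ y y0.
Proof. by rewrite /domination /= addrC subrK. Qed.

Lemma image_oppE (Y : zmodType) (D : set Y) (x : Y) :
  [set - d | d in D] x <-> D (- x).
Proof.
split=> [[d Dd <-]|DNx]; first by rewrite opprK.
by exists (- x); rewrite ?opprK.
Qed.

(** Solving [y = y0 - d] for [d] turns the translated set [y0 - D] into a
    condition on the difference [y0 - y], the form comparable with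
    [dominationB]. *)
Lemma EffP (Y : zmodType) (F D : set Y) (y0 : Y) :
  Eff F D y0 <-> F y0 /\ forall y, F y -> D (y0 - y) -> y = y0.
Proof.
split=> -[Fy0 eff]; split=> //.
  move=> y Fy Dy; apply: eff; split=> //.
  by exists (y0 - y); rewrite ?subKr.
by move=> y [Fy [d Dd dy]]; apply: eff => //; rewrite -dy subKr.
Qed.

(** Removing [- D] from [D] discards exactly the differences for which the
    preference between two points of [F] holds in both directions. *)
Lemma Min_const_domination (Y : zmodType) (F : set Y) (succ : Y -> Y -> Prop)
    (D : set Y) :
  (forall y, F y -> domination succ y = D) ->
  Min F succ = Eff F (D `\` [set - d | d in D]).
Proof.
move=> domD; have succE y y0 : F y -> succ y y0 = D (y0 - y).
  by move=> Fy; rewrite -dominationB domD.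
apply/seteqP; split=> y0.
  move=> [Fy0 min]; apply/EffP; split=> // y Fy [Dy NDy].
  case: NDy; apply/image_oppE; rewrite opprB -succE //.
  by apply: min => //; rewrite succE.
move=> /EffP[Fy0 eff]; split=> // y Fy; rewrite !succE // => Dy.
(* Otherwise [y0 - y] is in [D `\` - D], so [y = y0] and [y - y0] is the
   same difference [0] as [y0 - y]. *)
apply: contrapT => NDy; have yy0 : y = y0.
  by apply: eff => //; split=> // /image_oppE; rewrite opprB.
by apply: NDy; move: Dy; rewrite yy0.
Qed.

Lemma Eff_sub_Min (Y : zmodType) (F : set Y) (succ : Y -> Y -> Prop)
    (D : set Y) :
  (forall y, F y -> domination succ y `<=` D) -> Eff F D `<=` Min F succ.
Proof.
move=> domD y0 /EffP[Fy0 eff]; split=> // y Fy yy0.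
have eqy : y = y0 by apply: eff => //; apply: (domD y); rewrite ?dominationB.
by move: yy0; rewrite eqy.
Qed.

Lemma Min_sub_Eff (Y : zmodType) (F : set Y) (succ : Y -> Y -> Prop)
    (D : set Y) :
  Asymmetric succ \/ Antisymmetric Y eq succ ->
  (forall y, F y -> D `<=` domination succ y) -> Min F succ `<=` Eff F D.
Proof.
move=> asym Ddom y0 [Fy0 min]; apply/EffP; split=> // y Fy Dy.
have yy0 : succ y y0 by rewrite -dominationB; exact: Ddom.
have y0y := min y Fy yy0.
by case: asym => [/(_ _ _ yy0 y0y)[]|]; apply.
Qed.

Theorem proposition13 (R : realType) (Y : lmodType R) (F : set Y)
    (succ : Y -> Y -> Prop) (D : set Y) :
  [/\ (forall y, F y -> domination succ y = D) ->
        Min F succ = Eff F (D `\` [set - d | d in D]) /\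
        (Asymmetric succ \/ Antisymmetric Y eq succ ->
           Min F succ = Eff F D),
      (forall y, F y -> domination succ y `<=` D) ->
        Eff F D `<=` Min F succ
    & Asymmetric succ \/ Antisymmetric Y eq succ ->
      (forall y, F y -> D `<=` domination succ y) ->
        Min F succ `<=` Eff F D].
Proof.
split=> [domD||]; [|exact: Eff_sub_Min|exact: Min_sub_Eff].
split=> [|asym]; first exact: Min_const_domination.
by apply/seteqP; split; [apply: Min_sub_Eff | apply: Eff_sub_Min];
  rewrite // => y Fy; rewrite domD.
Qed.
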